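(* For every integer $n\ge 0$ and every complex number $a$, $$x^n=\sum_{k=0}^n p^{-\binom{k}{2}}\begin{bmatrix} n\\ k\end{bmatrix}_{p,q}(ap^{-k})^{n-k}(x\ominus a)_{p,q}^k .$$
   Context: $p,q$ are nonzero complex numbers with $p^n\neq q^n$ for all integers $n\ge 1$. $[n]_{p,q}=\dfrac{p^n-q^n}{p-q}$, $[n]_{p,q}!=\prod_{k=1}^{n}[k]_{p,q}$ for $n\ge 1$, $[0]_{p,q}!=1$, and $\begin{bmatrix} n\\ k\end{bmatrix}_{p,q}=\dfrac{[n]_{p,q}!}{[k]_{p,q}!\,[n-k]_{p,q}!}$ for $0\le k\le n$. The $(p,q)$-power is $(x\ominus a)_{p,q}^n=(x-a)(px-qa)\cdots(p^{n-1}x-q^{n-1}a)$ for $n\ge 1$ and $(x\ominus a)_{p,q}^0=1$. *)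

(* Defs.v *)
From mathcomp Require Import all_boot all_order all_algebra.

Set Implicit Arguments.
Unset Strict Implicit.
Unset Printing Implicit Defensive.

Import GRing.Theory.

Local Open Scope ring_scope.

Definition pqnum (F : fieldType) (p q : F) (n : nat) : F :=
  (p ^+ n - q ^+ n) / (p - q).

Definition pqfact (F : fieldType) (p q : F) (n : nat) : F :=
  \prod_(1 <= k < n.+1) pqnum p q k.

(* Meaningful only for k <= n; otherwise n - k is truncated to 0. *)
Definition pqbinom (F : fieldType) (p q : F) (n k : nat) : F :=
  pqfact p q n / (pqfact p q k * pqfact p q (n - k)).

Definition pqpow (F : fieldType) (p q x a : F) (n : nat) : F :=
  \prod_(0 <= i < n) (p ^+ i * x - q ^+ i * a).

(* Main.v *)
Require Import Defs.
From mathcomp Require Import all_boot all_order all_algebra.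
From mathcomp Require Import complex.
From mathcomp Require Import reals.
From mathcomp Require Import ring.

Import Order.TTheory GRing.Theory Num.Theory.

Local Open Scope ring_scope.

(** Induction on [n]: multiplying the expansion of [x ^+ n] by [x] and using
    [p ^+ k * x = (p ^+ k * x - q ^+ k * a) + q ^+ k * a] on the [k]-th term
    raises or keeps the index of the (p,q)-power, so that the claim reduces to
    the Pascal rule
    [[n+1, k+1] = p^(n-k) [n, k] + q^(k+1) [n, k+1]]. *)

Lemma pqfactS (F : fieldType) (p q : F) (n : nat) :
  pqfact p q n.+1 = pqfact p q n * pqnum p q n.+1.
Proof. by rewrite /pqfact big_nat_recr. Qed.

Lemma pqfact_neq0 (F : fieldType) (p q : F)
    (hpq : forall m : nat, (1 <= m)%N -> p ^+ m != q ^+ m) (n : nat) :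
  pqfact p q n != 0.
Proof.
rewrite /pqfact prodf_seq_neq0; apply/allP => k.
rewrite mem_index_iota => /andP[k_gt0 _] /=.
have pq1 : p - q != 0 by rewrite subr_eq0; have := hpq 1%N isT; rewrite !expr1.
by rewrite mulf_neq0 ?invr_eq0 // subr_eq0 hpq.
Qed.

(** Adding and subtracting [p ^+ m * q ^+ k] in the numerator splits it; this addition law is the
    source of the Pascal rule. *)
Lemma pqnumD (F : fieldType) (p q : F) (m k : nat) :
  pqnum p q (m + k) = p ^+ m * pqnum p q k + q ^+ k * pqnum p q m.
Proof. by rewrite /pqnum !exprD !mulrA -mulrDl; congr (_ / _); ring. Qed.

Lemma pqbinom0 (F : fieldType) (p q : F)
    (hpq : forall m : nat, (1 <= m)%N -> p ^+ m != q ^+ m) (n : nat) :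
  pqbinom p q n 0 = 1.
Proof.
by rewrite /pqbinom subn0 /(pqfact p q 0) big_geq // mul1r divff ?pqfact_neq0.
Qed.

Lemma pqbinomn (F : fieldType) (p q : F)
    (hpq : forall m : nat, (1 <= m)%N -> p ^+ m != q ^+ m) (n : nat) :
  pqbinom p q n n = 1.
Proof.
by rewrite /pqbinom subnn /(pqfact p q 0) big_geq // mulr1 divff ?pqfact_neq0.
Qed.

(** Apply the addition law to [n + 1 = (n - k) + (k + 1)]: each of the two summands cancels the last
    factor of one factorial in the denominator. The case [k = n] is excluded because truncated
    subtraction makes [pqbinom p q n n.+1] a nonzero junk value. *)
Lemma pqbinomS (F : fieldType) (p q : F)
    (hpq : forall m : nat, (1 <= m)%N -> p ^+ m != q ^+ m) (n k : nat)
    (lt_kn : (k < n)%N) :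
  pqbinom p q n.+1 k.+1 =
    p ^+ (n - k) * pqbinom p q n k + q ^+ k.+1 * pqbinom p q n k.+1.
Proof.
have [m ->] : exists m, n = (m.+1 + k)%N.
  by exists (n - k.+1)%N; rewrite addSnnS subnK.
have e1 : (m.+1 + k).+1 = (m.+1 + k.+1)%N by rewrite addnS.
have e2 : (m.+1 + k - k.+1 = m)%N by rewrite addSnnS addnK.
have := pqfact_neq0 _ _ _ hpq k.+1; have := pqfact_neq0 _ _ _ hpq m.+1.
rewrite /pqbinom subSS addnK e2 !pqfactS e1 pqnumD !(mulf_eq0 (pqfact _ _ _)) !negb_or.
by move=> /andP[m0 m1] /andP[k0 k1]; field; rewrite m0 m1 k0 k1.
Qed.

Definition taylor_coef {F : fieldType} (p q a : F) (n k : nat) : F :=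
  p ^- 'C(k, 2) * pqbinom p q n k * (a * p ^- k) ^+ (n - k).

Lemma taylor_coefS0 (F : fieldType) (p q : F)
    (hpq : forall m : nat, (1 <= m)%N -> p ^+ m != q ^+ m) (a : F) (n : nat) :
  taylor_coef p q a n.+1 0 = a * taylor_coef p q a n 0.
Proof.
by rewrite /taylor_coef !pqbinom0 // !subn0 !expr0 invr1 !mul1r mulr1 exprS.
Qed.

Lemma taylor_coefSn (F : fieldType) (p q : F)
    (hpq : forall m : nat, (1 <= m)%N -> p ^+ m != q ^+ m) (a : F) (n : nat) :
  taylor_coef p q a n.+1 n.+1 = p ^- n * taylor_coef p q a n n.
Proof.
rewrite /taylor_coef !pqbinomn // !subnn !expr0 !mulr1 binS bin1 exprD.
by rewrite invfM mulrC.
Qed.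

(** In the first Pascal term, [p ^+ (n - k)] turns the base [a * p ^- k.+1] of the power into
    [a * p ^- k]. In the second, one factor [a * p ^- k.+1] leaves the power. The remaining [p ^- k]
    comes from ['C(k.+1, 2) = 'C(k, 2) + k]. *)
Lemma taylor_coefSS (F : fieldType) (p q : F) (hp : p != 0)
    (hpq : forall m : nat, (1 <= m)%N -> p ^+ m != q ^+ m) (a : F) (n k : nat)
    (lt_kn : (k < n)%N) :
  taylor_coef p q a n.+1 k.+1 =
    p ^- k * taylor_coef p q a n k
      + p ^- k.+1 * (q ^+ k.+1 * a) * taylor_coef p q a n k.+1.
Proof.
rewrite /taylor_coef pqbinomS // subSS.
have [m e] : exists m, (n - k = m.+1)%N.
  by exists (n - k.+1)%N; rewrite -subSn // subSS.
have -> : (n - k.+1 = m)%N by rewrite subnS e.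
rewrite e binS bin1 exprD !exprMn (exprS p k) !exprVn !(exprS _ m) !exprMn.
by field; rewrite hp !expf_neq0.
Qed.

Lemma pqpowS (F : fieldType) (p q x a : F) (hp : p != 0) (k : nat) :
  x * pqpow p q x a k =
    p ^- k * (pqpow p q x a k.+1 + q ^+ k * a * pqpow p q x a k).
Proof.
rewrite {2}/pqpow big_nat_recr //= -/(pqpow p q x a k).
by field; rewrite expf_neq0.
Qed.

Lemma exprn_pqtaylor (F : fieldType) (p q : F) (hp : p != 0)
    (hpq : forall m : nat, (1 <= m)%N -> p ^+ m != q ^+ m) (n : nat) (a x : F) :
  x ^+ n = \sum_(0 <= k < n.+1) taylor_coef p q a n k * pqpow p q x a k.
Proof.
elim: n => [|n IHn].
  rewrite big_nat1 /taylor_coef pqbinom0 // /pqpow big_geq //.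
  by rewrite subnn !expr0 invr1 !mulr1.
rewrite exprS IHn mulr_sumr.
under eq_bigr => k _ do rewrite mulrCA pqpowS // mulrDr mulrDr.
(* The first sum holds the raised indices, the second the kept ones. Index [n.+1] arises only by
   raising and index [0] only by keeping, so these two terms are split off on both sides. *)
rewrite big_split /= big_nat_recr //= [X in _ + X]big_nat_recl //=.
rewrite [RHS]big_nat_recl //= [in RHS]big_nat_recr //=.
rewrite taylor_coefS0 // taylor_coefSn //.
(* Each inner index [k.+1] is reached both ways, from [k] and from [k.+1], which matches the
   coefficient recurrence. *)
have -> : \sum_(0 <= k < n) taylor_coef p q a n.+1 k.+1 * pqpow p q x a k.+1 =
    \sum_(0 <= k < n) taylor_coef p q a n k * (p ^- k * pqpow p q x a k.+1)
    + \sum_(0 <= k < n) taylor_coef p q a n k.+1 *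
        (p ^- k.+1 * (q ^+ k.+1 * a * pqpow p q x a k.+1)).
  rewrite -big_split /=; apply: eq_big_nat => k /andP[_ lt_kn].
  by rewrite taylor_coefSS //; ring.
rewrite !expr0 invr1; ring.
Qed.

Theorem corollary1 (R : realType) (p q : R[i]%C)
    (hp : p != 0) (hq : q != 0)
    (hpq : forall m : nat, (1 <= m)%N -> p ^+ m != q ^+ m)
    (n : nat) (a x : R[i]%C) :
  x ^+ n =
    \sum_(0 <= k < n.+1)
      p ^- 'C(k, 2) * pqbinom p q n k * (a * p ^- k) ^+ (n - k)
        * pqpow p q x a k.
Proof. exact: exprn_pqtaylor. Qed.
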